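(* Let $j\geq 4$ and $n\geq 2$ be integers. If $m_j(K_{1,2}, P_4, (n-1)K_2)= \lfloor \frac{2(n-1)}{j}\rfloor +1$, then $m_j(K_{1,2}, P_4, nK_2) \leq \lfloor \frac{2n}{j}\rfloor+1$.
   Context: $K_{j\times t}$ denotes the complete multipartite graph with $j$ partite classes of size $t$. $m_j(G_1,G_2,G_3)$ is the smallest positive integer $t$ such that every 3-coloring of the edges of $K_{j\times t}$ contains, for some $i\in\{1,2,3\}$, a copy of $G_i$ all of whose edges have color $i$. $K_{1,2}$ is the path on 3 vertices, $P_4$ the path on 4 vertices, and $mK_2$ the matching of $m$ disjoint edges (so $1K_2$ is a single edge). *)

(* Defs.v *)
From mathcomp Require Import all_boot.

Set Implicit Arguments.
Unset Strict Implicit.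
Unset Printing Implicit Defensive.

Record sgraph := SGraph {
  vertex :> finType;
  adj : rel vertex;
  adj_sym : symmetric adj;
  adj_irr : irreflexive adj }.
Arguments adj {s}.

Section Graphs.
Variables (a b j t k m : nat).

(* Vertex (p, x) is the x-th vertex of the p-th partite class. *)
Definition multipartite_rel : rel ('I_j * 'I_t)%type :=
  fun u v => u.1 != v.1.

Lemma multipartite_sym : symmetric multipartite_rel.
Proof. by move=> u v; rewrite /multipartite_rel eq_sym. Qed.

Lemma multipartite_irr : irreflexive multipartite_rel.
Proof. by move=> u; rewrite /multipartite_rel eqxx. Qed.

Definition complete_multipartite : sgraph :=
  SGraph multipartite_sym multipartite_irr.

Definition bipartite_rel : rel ('I_a + 'I_b)%type :=
  fun u v => match u, v with
             | inl _, inr _ | inr _, inl _ => true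
             | _, _ => false
             end.

Lemma bipartite_sym : symmetric bipartite_rel.
Proof. by move=> [x|x] [y|y]. Qed.

Lemma bipartite_irr : irreflexive bipartite_rel.
Proof. by move=> [x|x]. Qed.

Definition complete_bipartite : sgraph := SGraph bipartite_sym bipartite_irr.

Definition path_rel : rel 'I_k :=
  fun x y => (x.+1 == y :> nat) || (y.+1 == x :> nat).

Lemma path_rel_sym : symmetric path_rel.
Proof. by move=> x y; rewrite /path_rel orbC. Qed.

Lemma path_rel_irr : irreflexive path_rel.
Proof. by move=> x; rewrite /path_rel orbb gtn_eqF. Qed.

(* k is the number of vertices. *)
Definition path_graph : sgraph := SGraph path_rel_sym path_rel_irr.

(* The i-th edge joins (i, false) and (i, true). *)
Definition matching_rel : rel ('I_m * bool)%type :=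
  fun u v => (u.1 == v.1) && (u.2 != v.2).

Lemma matching_sym : symmetric matching_rel.
Proof.
by move=> u v; rewrite /matching_rel eq_sym; congr andb; rewrite eq_sym.
Qed.

Lemma matching_irr : irreflexive matching_rel.
Proof. by move=> u; rewrite /matching_rel !eqxx. Qed.

Definition matching_graph : sgraph := SGraph matching_sym matching_irr.

End Graphs.

(* The edge xy is the unordered pair [set x; y]. A colouring is a total
   function on vertex sets; only its values on edges of K are ever used. *)
Definition edge_coloring3 (K : sgraph) := {set K} -> 'I_3.

(* A copy of G in K is a subgraph, not necessarily induced. *)
Definition mono_copy (K : sgraph) (c : edge_coloring3 K) (i : 'I_3)
    (G : sgraph) : Prop :=
  exists f : G -> K, injective f /\
    forall x y : G, adj x y -> adj (f x) (f y) /\ c [set f x; f y] = i.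

Definition color1 : 'I_3 := @Ordinal 3 0 isT.
Definition color2 : 'I_3 := @Ordinal 3 1 isT.
Definition color3 : 'I_3 := @Ordinal 3 2 isT.

Definition arrows3 (K G1 G2 G3 : sgraph) : Prop :=
  forall c : edge_coloring3 K,
    [\/ mono_copy c color1 G1, mono_copy c color2 G2 | mono_copy c color3 G3].

(* The graph of the partial function m_j: no positive integer with the arrow
   property need exist, so "m_j(G1, G2, G3) = t" is a relation. *)
Definition is_multipartite_ramsey (j : nat) (G1 G2 G3 : sgraph) (t : nat)
    : Prop :=
  [/\ 0 < t,
      arrows3 (complete_multipartite j t) G1 G2 G3
    & forall s : nat, 0 < s ->
        arrows3 (complete_multipartite j s) G1 G2 G3 -> t <= s].

(* "m_j(G1, G2, G3) <= b", which includes the existence of m_j(G1, G2, G3). *)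
Definition multipartite_ramsey_le (j : nat) (G1 G2 G3 : sgraph) (b : nat)
    : Prop :=
  exists2 t : nat, is_multipartite_ramsey j G1 G2 G3 t & t <= b.

(* Main.v *)
(* The colour-3 matching is enlarged one edge at a time, as long as it leaves a
   set U of at least three vertices uncovered.  Let N be the graph of the edges
   of colour 1 or 2.  Colour 1 is a matching and colour 2 has no path on four
   vertices, so every vertex of a 4-cycle of N has a colour-1 edge in it; hence
   N contains neither K_{2,3} nor K_4 minus an edge, nor two 4-cycles x u y v
   and x' u y' w with {x, y} and {x', y'} disjoint.

   If the matching cannot be enlarged, then U is independent in colour 3.
   - If U meets three classes, a vertex of a fourth class sends colour-3 edges
     to two of the representatives and its partner sends one to at least one of
     them: an augmenting path.
   - If U lies in two classes P and Q, counting gives two matching edges avoiding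
     P and Q.  Fix three vertices of U.  Without an augmenting path, each of the
     two edges has an end joined in N to all three, or has both ends joined in N
     to the same two of them, and every combination is excluded above.

   As jt > 2n for t = floor(2n/j) + 1, fewer than n edges always leave at least
   three vertices uncovered. *)
Require Import Defs.
From mathcomp Require Import all_boot zify.
From Stdlib Require Import Classical.

Set Implicit Arguments.
Unset Strict Implicit.
Unset Printing Implicit Defensive.

(** * Four-cycles in the union of the first two colours *)

Definition union_rel (T : Type) (E1 E2 : rel T) : rel T :=
  fun x y => E1 x y || E2 x y.

Section TwoColours.
Variables (V : finType) (E1 E2 : rel V).
Hypothesis E1_sym : symmetric E1.
Hypothesis E2_sym : symmetric E2.
Hypothesis E1_irr : irreflexive E1.
Hypothesis E2_irr : irreflexive E2.
Hypothesis E1_deg : forall x y z, E1 x y -> E1 x z -> y = z.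
Hypothesis E2_path : forall a b c d,
  uniq [:: a; b; c; d] -> E2 a b -> E2 b c -> E2 c d -> False.

Local Notation N := (union_rel E1 E2).

Lemma union_sym : symmetric N.
Proof. by move=> x y; rewrite /union_rel E1_sym E2_sym. Qed.

Lemma union_neq x y : N x y -> x != y.
Proof. by apply: contraL => /eqP->; rewrite /union_rel E1_irr E2_irr. Qed.

(** If [u] had no colour-1 edge in the cycle, [x u y] would be a path of colour 2. Neither end of it
    extends to [v] in colour 2, so [v] would have two colour-1 neighbours. *)
Lemma four_cycle x y u v : x != y -> u != v ->
    N x u -> N x v -> N y u -> N y v -> E1 u x \/ E1 u y.
Proof.
move=> xy uv xu xv yu yv.
have U : uniq [:: x; u; y; v].
  rewrite /= !inE !negb_or xy uv (union_neq xu) (union_neq xv) (union_neq yv).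
  by rewrite eq_sym (union_neq yu).
have U' : uniq [:: y; u; x; v].
  move: U; rewrite /= !inE !negb_or [y == x]eq_sym [u == x]eq_sym [y == u]eq_sym.
  by do ![case: (_ == _)].
case ux: (E1 u x); [by left|case uy: (E1 u y); [by right|exfalso]].
move: (xu) (yu); rewrite /union_rel [E1 x u]E1_sym [E1 y u]E1_sym ux uy /= => xu2 yu2.
have uy2 : E2 u y by rewrite E2_sym.
have ux2 : E2 u x by rewrite E2_sym.
have vy : E1 v y.
  by case/orP: yv; [rewrite E1_sym|move/(E2_path U xu2 uy2)].
have vx : E1 v x.
  by case/orP: xv; [rewrite E1_sym|move/(E2_path U' yu2 ux2)].
by move/eqP: xy; apply; apply: E1_deg vx vy.
Qed.

(** The only colour-1 neighbour of [u] would lie in both of two disjoint pairs. *)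
Lemma no_two_four_cycles x y x' y' u v w :
    x != y -> x' != y' -> [disjoint [:: x; y] & [:: x'; y']] ->
    u != v -> u != w ->
    N x u -> N x v -> N y u -> N y v -> N x' u -> N x' w -> N y' u -> N y' w ->
  False.
Proof.
move=> xy x'y' dis uv uw xu xv yu yv x'u x'w y'u y'w.
have meet z z' : z \in [:: x; y] -> z' \in [:: x'; y'] -> E1 u z -> E1 u z' -> False.
  move=> zin z'in uz uz'; rewrite -(E1_deg uz uz') in z'in.
  by move: (disjointFr dis zin); rewrite z'in.
by case: (four_cycle xy uv xu xv yu yv) => h;
   case: (four_cycle x'y' uw x'u x'w y'u y'w) => h';
   apply: (meet _ _ _ _ h h'); rewrite !inE eqxx ?orbT.
Qed.

(** Each pair from [a], [b], [c] closes a 4-cycle with [u] and [v], so it contains the colour-1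
    neighbour of [u]; no vertex lies in all three pairs. *)
Lemma no_K23 a b c u v : uniq [:: a; b; c] -> u != v ->
  N a u -> N b u -> N c u -> N a v -> N b v -> N c v -> False.
Proof.
rewrite /= !inE negb_or => /and3P[/andP[ab ac] bc _] uv au bu cu av bv cv.
have at_most y z : y != z -> E1 u y -> E1 u z -> False.
  by move=> /eqP yz uy uz; apply: yz; apply: E1_deg uy uz.
have := four_cycle ab uv au av bu bv.
have := four_cycle ac uv au av cu cv.
have := four_cycle bc uv bu bv cu cv.
by case=> h1 [] h2 [] h3; first
  [exact: (at_most _ _ ab) | exact: (at_most _ _ ac) | exact: (at_most _ _ bc)].
Qed.

(** The colour-1 edges at [u] and [v] go to [a] and [b], so the chord [uv] has colour 2. If [ua] has
    colour 1, then so does [vb], and [a v u b] is a path of colour 2. *)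
Lemma no_diamond a b u v : a != b ->
  N a u -> N a v -> N b u -> N b v -> N u v -> False.
Proof.
move=> ab au av bu bv uv.
have nuv := union_neq uv.
have at_most x y z : y != z -> E1 x y -> E1 x z -> False.
  by move=> /eqP yz xy xz; apply: yz; apply: E1_deg xy xz.
have uab := four_cycle ab nuv au av bu bv.
have vab : E1 v a \/ E1 v b by apply: (four_cycle ab _ av au bv bu); rewrite eq_sym.
have uv2 : E2 v u.
  case/orP: uv => [uv|]; last by rewrite E2_sym.
  by case: uab => /(E1_deg uv) eqv; [move: av|move: bv];
     rewrite -eqv => /union_neq; rewrite eqxx.
wlog ua : a b ab au av bu bv uab vab / E1 u a => [wl|].
  case: (uab) => ua; first exact: (wl a b).
  apply: (wl b a); rewrite // 1?eq_sym //; by [case: uab; auto | case: vab; auto].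
have nva : E1 v a = false.
  by apply/negP => va; apply: (at_most a u v) => //; rewrite E1_sym.
have vb : E1 v b by case: vab => //; rewrite nva.
have nub : E1 u b = false.
  by apply/negP => /(at_most _ _ _ ab ua).
apply: (E2_path (a := a) (b := v) (c := u) (d := b)) => //.
- rewrite /= !inE !negb_or ab (union_neq au) (union_neq av) [v == u]eq_sym nuv.
  by rewrite [v == b]eq_sym [u == b]eq_sym (union_neq bu) (union_neq bv).
- by move: av; rewrite /union_rel E1_sym nva.
- by move: bu; rewrite /union_rel E1_sym nub /= E2_sym.
Qed.

End TwoColours.

(** * Extending and augmenting a matching *)

Section Matchings.
Variables (V : finType) (E : rel V).
Hypothesis E_sym : symmetric E.

Definition is_matching m (f : 'I_m * bool -> V) :=
  injective f /\ forall i b, E (f (i, b)) (f (i, ~~ b)).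

Lemma matching_extend m (f : 'I_m * bool -> V) u v :
    is_matching f -> u \notin codom f -> v \notin codom f -> u != v -> E u v ->
  exists f' : 'I_m.+1 * bool -> V, is_matching f'.
Proof.
move=> [fI fE] uf vf uv Euv.
have notf w k : w \notin codom f -> f k = w -> False.
  by move=> wf fk; rewrite -fk codom_f in wf.
exists (fun k => if unlift ord_max k.1 is Some i then f (i, k.2)
                 else if k.2 then u else v); split.
  move=> [k b] [k' b'] /=.
  case: unliftP => [i ->|->]; case: unliftP => [i' ->|->].
  - by move/fI => [-> ->].
  - by case: b' => /notf [].
  - by case: b => /esym/notf [].
  - case: b; case: b' => // e; move: uv; by rewrite e eqxx.
move=> k b /=; case: unliftP => [i _|_]; first exact: fE.
by case: b => //=; rewrite E_sym.
Qed.

(** Along the augmenting path [u], [f (i, b)], [f (i, ~~ b)], [v], the middle edge is first replaced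
    by the one at [u]; this frees [f (i, ~~ b)], and the edge to [v] is then added. *)
Lemma matching_augment m (f : 'I_m * bool -> V) i b u v :
    is_matching f -> u \notin codom f -> v \notin codom f -> u != v ->
    E (f (i, b)) u -> E (f (i, ~~ b)) v ->
  exists f' : 'I_m.+1 * bool -> V, is_matching f'.
Proof.
move=> [fI fE] uf vf uv xu yv.
have notf w k : w \notin codom f -> f k != w.
  by apply: contraNneq => <-; rewrite codom_f.
pose g k := if k == (i, ~~ b) then u else f k.
have notg w : w != u -> (forall k, k != (i, ~~ b) -> f k != w) -> w \notin codom g.
  move=> wu wf; apply/codomP => -[k]; rewrite /g.
  case: eqP => [_ e|/eqP k' e]; first by rewrite e eqxx in wu.
  by move: (wf k k'); rewrite e eqxx.
have gM : is_matching g.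
  split=> [k k'|k c]; rewrite /g.
    case: eqP => [->|_]; case: eqP => [->|_] //; last exact: fI.
      by move/esym/eqP; rewrite (negPf (notf _ _ uf)).
    by move/eqP; rewrite (negPf (notf _ _ uf)).
  rewrite !xpair_eqE; case: eqP => [->|_]; last exact: fE.
  by case: b c xu {yv g notg} => -[] xu //=; rewrite E_sym.
apply: (matching_extend gM (u := f (i, ~~ b)) (v := v)) => //.
- by apply: notg => [|k]; [exact: notf|rewrite (inj_eq fI)].
- by apply: notg => [|k _]; [rewrite eq_sym|exact: notf].
- exact: notf.
Qed.

End Matchings.

(** * A maximal colour-3 matching with three uncovered vertices is contradictory *)

Section Augmentation.
Variables (V I : finType) (p : V -> I) (t : nat) (E1 E2 E3 : rel V).
Hypothesis part_card : forall i, #|[set x | p x == i]| <= t.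
Hypothesis V_card : 4 * t <= #|V|.
Hypothesis E1_sym : symmetric E1.
Hypothesis E2_sym : symmetric E2.
Hypothesis E3_sym : symmetric E3.
Hypothesis E1_irr : irreflexive E1.
Hypothesis E2_irr : irreflexive E2.
Hypothesis E1_deg : forall x y z, E1 x y -> E1 x z -> y = z.
Hypothesis E2_path : forall a b c d,
  uniq [:: a; b; c; d] -> E2 a b -> E2 b c -> E2 c d -> False.
Hypothesis colored : forall x y, p x != p y -> [|| E1 x y, E2 x y | E3 x y].

Local Notation N := (union_rel E1 E2).

Let N_sym : symmetric N := union_sym E1_sym E2_sym.
Let N_diamond := no_diamond E1_sym E2_sym E1_irr E2_irr E1_deg E2_path.
Let N_K23 := no_K23 E1_sym E2_sym E1_irr E2_irr E1_deg E2_path.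
Let N_four_cycles := no_two_four_cycles E1_sym E2_sym E1_irr E2_irr E1_deg E2_path.

Variables (m : nat) (f : 'I_m * bool -> V).
Hypothesis fM : is_matching E3 f.
Hypothesis m_small : 2 * m + 3 <= #|V|.
Hypothesis f_max : ~ exists f' : 'I_m.+1 * bool -> V, is_matching E3 f'.

Let U := [set x | x \notin codom f].

Lemma colored_N x y : p x != p y -> ~~ E3 x y -> N x y.
Proof. by move/colored; rewrite /union_rel orbA => /orP[|->]. Qed.

Lemma unmatched_N u v : u \in U -> v \in U -> p u != p v -> N u v.
Proof.
rewrite !inE => uU vU uv; apply: colored_N => //; apply/negP => Euv; apply: f_max.
by apply: (matching_extend E3_sym fM uU vU) => //; apply: contraNneq uv => ->.
Qed.

Lemma no_augmentation i b u v : u \in U -> v \in U -> u != v ->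
  E3 (f (i, b)) u -> E3 (f (i, ~~ b)) v -> False.
Proof.
rewrite !inE => uU vU uv xu yv; apply: f_max.
exact: (matching_augment E3_sym fM uU vU uv xu yv).
Qed.

Lemma card_unmatched : 2 * m + #|U| = #|V|.
Proof.
have -> : U = ~: [set x in codom f] by apply/setP => x; rewrite !inE.
rewrite -(cardsC [set x in codom f]); congr addn.
by rewrite cardsE card_codom ?card_prod ?card_ord ?card_bool 1?mulnC //; case: fM.
Qed.

Lemma unmatched_parts u1 u2 u3 :
    u1 \in U -> u2 \in U -> u3 \in U ->
    p u1 != p u2 -> p u1 != p u3 -> p u2 != p u3 ->
  False.
Proof.
move=> U1 U2 U3 p12 p13 p23.
have Np (x y : V) : p x != p y -> x != y by apply: contraNneq => ->.
pose part i := [set x | p x == i].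
(* Three classes hold at most 3t vertices. Since [m_small] makes [V] nonempty, [4 * t <= #|V|]
   leaves a vertex over even for t = 0. *)
have [v] : exists v, v \in ~: (part (p u1) :|: part (p u2) :|: part (p u3)).
  apply/set0Pn; rewrite -card_gt0.
  have := cardsC (part (p u1) :|: part (p u2) :|: part (p u3)).
  have := (leq_card_setU (part (p u1) :|: part (p u2)) (part (p u3))).1.
  have := (leq_card_setU (part (p u1)) (part (p u2))).1.
  have := part_card (p u1); have := part_card (p u2); have := part_card (p u3).
  by move: V_card m_small; rewrite /part; lia.
rewrite !inE !negb_or => /andP[/andP[v1 v2] v3].
have n12 := unmatched_N U1 U2 p12.
have n13 := unmatched_N U1 U3 p13.
have n23 := unmatched_N U2 U3 p23.
(* If [z] were joined in [N] to both [a] and [b], then [z], [c] and the chord [ab] would form a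
   diamond. *)
have two a b c z : N a b -> N a c -> N b c -> z != c ->
    p z != p a -> p z != p b -> E3 z a || E3 z b.
  move=> ab ac bc zc za zb; apply/norP => -[/(colored_N za) na /(colored_N zb) nb].
  have ca : N c a by rewrite N_sym.
  have cb : N c b by rewrite N_sym.
  exact: N_diamond zc na nb ca cb ab.
have n21 : N u2 u1 by rewrite N_sym.
have n31 : N u3 u1 by rewrite N_sym.
have n32 : N u3 u2 by rewrite N_sym.
have v12 : E3 v u1 || E3 v u2 by apply: (two _ _ u3) => //; apply: Np.
have v13 : E3 v u1 || E3 v u3 by apply: (two _ _ u2) => //; apply: Np.
have v23 : E3 v u2 || E3 v u3 by apply: (two _ _ u1) => //; apply: Np.
have [vU|] := boolP (v \in U).
  have notE3 u : u \in U -> p v != p u -> E3 v u = false.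
    move=> uU vu; apply/negP => Evu; apply: f_max.
    move: vU uU; rewrite !inE => vU uU.
    exact: (matching_extend E3_sym fM vU uU (Np _ _ vu)).
  by move: v12; rewrite !notE3.
rewrite inE negbK => /codomP[[i b] vf].
set w := f (i, ~~ b).
have wU u : u \in U -> w != u.
  by rewrite inE; apply: contraNneq => <-; exact: codom_f.
have aug a c : a \in U -> c \in U -> p a != p c -> E3 v a -> E3 w c -> False.
  by move=> aU cU /Np ac; rewrite vf; exact: no_augmentation.
(* The partner [w] may share a class with one representative. That one then serves as the third
   triangle vertex in [two], where only its being distinct from [w] matters. *)
have [c cs Ewc] : exists2 c, c \in [:: u1; u2; u3] & E3 w c.
  have [w1|w1] := eqVneq (p w) (p u1).
    have /orP[h|h] : E3 w u2 || E3 w u3.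
      by apply: (two _ _ u1); rewrite ?wU ?w1 //.
    - by exists u2; rewrite // !inE eqxx !orbT.
    - by exists u3; rewrite // !inE eqxx !orbT.
  have [w2|w2] := eqVneq (p w) (p u2).
    have /orP[h|h] : E3 w u1 || E3 w u3.
      by apply: (two _ _ u2); rewrite ?wU ?w2 // eq_sym.
    - by exists u1; rewrite // !inE eqxx.
    - by exists u3; rewrite // !inE eqxx !orbT.
  have /orP[h|h] : E3 w u1 || E3 w u2 by apply: (two _ _ u3); rewrite ?wU.
  - by exists u1; rewrite // !inE eqxx.
  - by exists u2; rewrite // !inE eqxx !orbT.
(* Since [v] sends colour-3 edges to at least two representatives, one of them differs from [c]. *)
move: cs; rewrite !inE => /or3P[] /eqP ec; subst c.
- by case/orP: v23 => h; apply: (aug _ _ _ _ _ h Ewc); rewrite // eq_sym.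
- by case/orP: v13 => h; apply: (aug _ _ _ _ _ h Ewc); rewrite // eq_sym.
- by case/orP: v12 => h; apply: (aug _ _ _ _ _ h Ewc).
Qed.

(** [P] and [Q] hold at most 2t vertices, [U] among them, so at most 2t - |U| matched ends lie
    there. Discarding these ends and their partners leaves at least 2m - 2(2t - |U|) = |V| + |U| -
    4t >= |U| >= 3 ends. *)
Lemma two_full_edges P Q : {in U, forall u, p u \in [:: P; Q]} ->
  exists i i', i != i' /\
    forall b, p (f (i, b)) \notin [:: P; Q] /\ p (f (i', b)) \notin [:: P; Q].
Proof.
move=> UPQ; case: fM => fI _.
pose A := [set k | p (f k) \notin [:: P; Q]].
pose flip (k : 'I_m * bool) := (k.1, ~~ k.2).
have flipK : involutive flip by case=> i b; rewrite /flip /= negbK.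
have PQ_card : #|[set x | p x \in [:: P; Q]]| <= 2 * t.
  have -> : [set x | p x \in [:: P; Q]] = [set x | p x == P] :|: [set x | p x == Q].
    by apply/setP => x; rewrite !inE.
  have := (leq_card_setU [set x | p x == P] [set x | p x == Q]).1.
  by have := part_card P; have := part_card Q; lia.
have CA_card : #|~: A| + #|U| <= 2 * t.
  apply: leq_trans PQ_card; rewrite -(card_imset _ fI) -cardsUI.
  have -> : (f @: (~: A)) :&: U = set0.
    apply/setP => x; rewrite !inE; apply/negP => /andP[/imsetP[k _ ->]].
    by rewrite codom_f.
  rewrite cards0 addn0; apply/subset_leq_card/subsetP => x.
  rewrite in_setU [in X in _ -> X]inE.
  by case/orP => [/imsetP[k]|/UPQ //]; rewrite inE inE negbK => ? ->.
have A_card : #|A| + #|~: A| = 2 * m.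
  by rewrite cardsC card_prod card_ord card_bool mulnC.
(* An edge contributes only two indices, so three indices involve two different edges. *)
have /card_gt2P[k1 [k2 [k3 [[B1 B2 B3] [n12 n23 n31]]]]] : 2 < #|A :&: flip @^-1: A|.
  have := cardsID (flip @^-1: A) A.
  have : #|A :\: flip @^-1: A| <= #|~: A|.
    rewrite -(card_preimset (~: A) (inv_inj flipK)).
    by apply/subset_leq_card/subsetP => k; rewrite !inE => /andP[].
  by move: card_unmatched V_card m_small; lia.
have full k : k \in A :&: flip @^-1: A -> forall b, p (f (k.1, b)) \notin [:: P; Q].
  by case: k => i [] /setIP[]; rewrite !in_set => h h1 [].
have [k [k' [kB k'B kk']]] : exists k k',
    [/\ k \in A :&: flip @^-1: A, k' \in A :&: flip @^-1: A & k.1 != k'.1].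
  have [e12|] := eqVneq k1.1 k2.1; last by exists k1, k2.
  have [e13|] := eqVneq k1.1 k3.1; last by exists k1, k3.
  move: n12 n23 n31; rewrite -!pair_eqE /pair_eq /= -e12 -e13 eqxx /=.
  by case: k1.2 k2.2 k3.2 => [] [] [].
by exists k.1, k'.1; split=> // b; split; exact: full.
Qed.

(** If both ends have colour-3 neighbours in [S], the lack of an augmenting path makes all of these
    the same vertex [z]. Otherwise one end has none. *)
Lemma full_edge_type (S : seq V) i : {subset S <= U} ->
    (forall b, {in S, forall u, p (f (i, b)) != p u}) ->
  (exists b, {in S, forall u, N (f (i, b)) u}) \/
  (exists z, forall b, {in S, forall u, u != z -> N (f (i, b)) u}).
Proof.
move=> SU pS.
have [/hasP[z zS Ez]|/hasPn no0] := boolP (has (E3 (f (i, false))) S); last first.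
  by left; exists false => u uS; rewrite colored_N ?pS ?no0.
have [/hasP[z' z'S Ez']|/hasPn no1] := boolP (has (E3 (f (i, true))) S); last first.
  by left; exists true => u uS; rewrite colored_N ?pS ?no1.
have zz' : z' = z.
  apply/eqP/negPn/negP => zz'.
  exact: (no_augmentation (SU _ z'S) (SU _ zS) zz' Ez' Ez).
right; exists z => b u uS uz; apply: colored_N; first exact: pS.
apply/negP => Eu; apply: (no_augmentation (SU _ uS) (SU _ zS) uz Eu).
by case: b Eu; rewrite /= -?zz' // zz'.
Qed.

Lemma no_two_full_edges u1 u2 u3 i i' : i != i' ->
    uniq [:: u1; u2; u3] -> {subset [:: u1; u2; u3] <= U} ->
    (forall b, {in [:: u1; u2; u3], forall u, p (f (i, b)) != p u}) ->
    (forall b, {in [:: u1; u2; u3], forall u, p (f (i', b)) != p u}) ->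
  False.
Proof.
set S := [:: u1; u2; u3] => ii' uS SU ip ip'; case: fM => fI _.
have [S1 S2 S3] : [/\ u1 \in S, u2 \in S & u3 \in S] by rewrite !inE !eqxx !orbT.
have pick z z' : exists2 u, u \in S & (u != z) && (u != z').
  apply/hasP/negPn/negP => /hasPn noS.
  have : size S <= size [:: z; z'].
    by apply: uniq_leq_size => // u /noS; rewrite !inE negb_and !negbK.
  by [].
(* Two vertices of [S] other than [z] are joined in [N] to both ends of edge [l] and to one end of
   edge [k], a K_{2,3}. *)
have mixed k l : k != l -> (exists b, {in S, forall u, N (f (k, b)) u}) ->
    (exists z, forall b, {in S, forall u, u != z -> N (f (l, b)) u}) -> False.
  move=> kl [b Nk] [z Nl].
  have [u uinS /andP[uz _]] := pick z z; have [v vinS /andP[vz vu]] := pick z u.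
  apply: (@N_K23 (f (k, b)) (f (l, false)) (f (l, true)) u v);
    rewrite ?Nk ?Nl //; last by rewrite eq_sym.
  by rewrite /= !inE !(inj_eq fI) !xpair_eqE (negPf kl) eqxx.
case: (full_edge_type SU ip) (full_edge_type SU ip') => hi [] hi'.
- case: hi hi' => [b Ni] [b' Ni'].
  apply: (@N_K23 u1 u2 u3 (f (i, b)) (f (i', b')));
    rewrite // 1?N_sym ?Ni ?Ni' //.
  by rewrite (inj_eq fI) xpair_eqE (negPf ii').
- exact: mixed ii' hi hi'.
- by apply: mixed hi' hi; rewrite eq_sym.
case: hi hi' => [z Ni] [z' Ni'].
(* Both edges omit at most one vertex of [S]. The vertex [u] avoids both exceptions and is common to
   the two 4-cycles; [v] and [w] complete them and may coincide. *)
have [u uinS /andP[uz uz']] := pick z z'.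
have [v vinS /andP[vz vu]] := pick z u; have [w winS /andP[wz wu]] := pick z' u.
apply: (@N_four_cycles
  (f (i, false)) (f (i, true)) (f (i', false)) (f (i', true)) u v w);
  rewrite ?Ni ?Ni' ?(inj_eq fI) ?xpair_eqE ?eqxx ?andbF // 1?eq_sym //.
rewrite disjoint_has /= !inE !(inj_eq fI) !xpair_eqE.
by rewrite (negPf ii').
Qed.

Lemma augmentation : False.
Proof.
have /card_gt2P[u1 [u2 [u3 [[U1 U2 U3] [n12 n23 n31]]]]] : 2 < #|U|.
  by move: card_unmatched m_small; lia.
(* When [U] lies in a single class, [P] and [Q] are taken equal. *)
have [P [Q UPQ]] : exists P Q, {in U, forall u, p u \in [:: P; Q]}.
  have [/existsP[a /existsP[b /and3P[aU bU ab]]]|/existsPn same] :=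
    boolP [exists a, exists b, [&& a \in U, b \in U & p a != p b]].
    exists (p a), (p b) => u uU; rewrite !inE; apply/negPn/negP => /norP[ua ub].
    by apply: (unmatched_parts aU bU uU ab); rewrite eq_sym.
  exists (p u1), (p u1) => u uU; rewrite !inE orbb.
  by move/existsPn/(_ u1): (same u); rewrite uU U1 /= negbK.
have [i [i' [ii' full]]] := two_full_edges UPQ.
have SU : {subset [:: u1; u2; u3] <= U}.
  by move=> u; rewrite !in_cons in_nil orbF => /or3P[] /eqP->.
apply: (no_two_full_edges ii' _ SU).
- by rewrite /= !inE negb_or n12 n23 eq_sym n31.
- by move=> b u /SU/UPQ uPQ; apply: contraTneq uPQ => <-; case: (full b).
- by move=> b u /SU/UPQ uPQ; apply: contraTneq uPQ => <-; case: (full b).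
Qed.

End Augmentation.

(** * From colour relations to monochromatic copies *)

Lemma mono_K12 (K : sgraph) (c : edge_coloring3 K) i (x y z : K) :
    y != z -> adj x y -> adj x z -> c [set x; y] = i -> c [set x; z] = i ->
  mono_copy c i (complete_bipartite 1 2).
Proof.
move=> yz xy xz cy cz.
have irr (u v : K) : adj u v -> u != v.
  by apply: contraTneq => ->; rewrite adj_irr.
exists (fun v => match v with inl _ => x | inr b => if b == ord0 then y else z end).
have b1 (b : 'I_2) : b != ord0 -> b = ord_max.
  by case: b => -[|[|//]] // h _; apply: val_inj.
have xE (b : 'I_2) : adj x (if b == ord0 then y else z) /\
    c [set x; if b == ord0 then y else z] = i by case: ifP.
split; last first.
  by move=> [a|b] [a'|b'] //= _; rewrite 1?adj_sym 1?setUC; apply: xE.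
move=> [a|b] [a'|b'] /=.
- by rewrite (ord1 a) (ord1 a').
- by case: ifP => _ /eqP; rewrite (negPf (irr _ _ _)).
- by case: ifP => _ /eqP; rewrite eq_sym (negPf (irr _ _ _)).
case: eqP => [->|/eqP/b1->]; case: eqP => [->|/eqP/b1->] // /eqP; first by rewrite (negPf yz).
by rewrite eq_sym (negPf yz).
Qed.

Lemma mono_P4 (K : sgraph) (c : edge_coloring3 K) i (x y z w : K) :
    uniq [:: x; y; z; w] -> adj x y -> adj y z -> adj z w ->
    c [set x; y] = i -> c [set y; z] = i -> c [set z; w] = i ->
  mono_copy c i (path_graph 4).
Proof.
move=> U xy yz zw cxy cyz czw.
exists (tnth [tuple x; y; z; w]); split; first exact/tuple_uniqP.
have E (a b : 'I_4) : a.+1 = b ->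
    adj (tnth [tuple x; y; z; w] a) (tnth [tuple x; y; z; w] b) /\
    c [set tnth [tuple x; y; z; w] a; tnth [tuple x; y; z; w] b] = i.
  rewrite !(tnth_nth x) => ab; have := ltn_ord b; rewrite -ab.
  by case: (val a) => [|[|[|]]] //= _; rewrite ?cxy ?cyz ?czw.
move=> a b /orP[/eqP/E //|/eqP/E].
by rewrite adj_sym setUC.
Qed.

Definition color_rel (K : sgraph) (c : edge_coloring3 K) i : rel K :=
  fun x y => adj x y && (c [set x; y] == i).

Lemma color_sym (K : sgraph) (c : edge_coloring3 K) i : symmetric (color_rel c i).
Proof. by move=> x y; rewrite /color_rel adj_sym setUC. Qed.

Lemma color_irr (K : sgraph) (c : edge_coloring3 K) i : irreflexive (color_rel c i).
Proof. by move=> x; rewrite /color_rel adj_irr. Qed.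

Lemma mono_matching (K : sgraph) (c : edge_coloring3 K) i m (f : 'I_m * bool -> K) :
  is_matching (color_rel c i) f -> mono_copy c i (matching_graph m).
Proof.
move=> [fI fE]; exists f; split=> // -[k b] [k' b'] /andP[/= /eqP<- bb'].
have -> : b' = ~~ b by case: b b' bb' => [] [].
by case/andP: (fE k b) => ? /eqP.
Qed.

(** * The arrow property and the bound *)

(** Without copies of the first two graphs, colours 1 and 2 satisfy [E1_deg] and [E2_path], so
    [augmentation] enlarges any colour-3 matching of m < n edges: 2m + 2 <= 2n < jt leaves three
    vertices uncovered. *)
Lemma arrows_of_large j t n : 4 <= j -> 2 * n < j * t ->
  arrows3 (complete_multipartite j t)
    (complete_bipartite 1 2) (path_graph 4) (matching_graph n).
Proof.
move=> hj hn c; set K := complete_multipartite j t in c *.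
case: (classic (mono_copy c color1 (complete_bipartite 1 2))) => [|no1]; first by constructor 1.
case: (classic (mono_copy c color2 (path_graph 4))) => [|no2]; first by constructor 2.
constructor 3.
have cardK : #|K| = j * t by rewrite card_prod !card_ord.
suff : forall m, m <= n -> exists f : 'I_m * bool -> K, is_matching (color_rel c color3) f.
  by case/(_ n (leqnn n)) => f /mono_matching.
elim=> [_|m IH mn].
  have f0 (k : 'I_0 * bool) : K by case: k => -[].
  by exists f0; split=> [[[]]|[]].
have [f fM] := IH (ltnW mn).
apply: NNPP => f_max.
apply: (@augmentation K 'I_j (fun x => x.1) t
  (color_rel c color1) (color_rel c color2) (color_rel c color3)
  _ _ _ _ _ _ _ _ _ _ m f fM _ f_max).
- move=> i; rewrite -[X in _ <= X]card_ord -cardsT.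
  rewrite -(card_imset setT (f := pair i)); last by move=> ? ? [].
  by apply/subset_leq_card/subsetP => -[q x]; rewrite inE /= => /eqP->; apply: imset_f.
- by rewrite cardK leq_mul2r hj orbT.
- exact: color_sym.
- exact: color_sym.
- exact: color_sym.
- exact: color_irr.
- exact: color_irr.
- move=> x y z /andP[xy /eqP cxy] /andP[xz /eqP cxz].
  by apply/eqP/negPn/negP => yz; apply: no1; exact: (mono_K12 yz xy xz).
- move=> x y z w U /andP[xy /eqP cxy] /andP[yz /eqP cyz] /andP[zw /eqP czw].
  by apply: no2; exact: (mono_P4 U xy yz zw).
- move=> x y xy; rewrite /color_rel [adj _ _]xy /=.
  by case: (c _) => -[|[|[|]]].
- by rewrite cardK; lia.
Qed.

Theorem theorem6 (j n : nat) (hj : 4 <= j) (hn : 2 <= n)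
    (hm : is_multipartite_ramsey j
            (complete_bipartite 1 2) (path_graph 4) (matching_graph (n - 1))
            ((2 * (n - 1)) %/ j + 1)) :
  multipartite_ramsey_le j
    (complete_bipartite 1 2) (path_graph 4) (matching_graph n)
    ((2 * n) %/ j + 1).
Proof.
set A := fun t => arrows3 (complete_multipartite j t)
  (complete_bipartite 1 2) (path_graph 4) (matching_graph n).
(* The relational form of the bound asks for an exact minimum, so a least positive witness is
   extracted by strong induction. *)
have least t : 0 < t -> A t ->
    exists2 s, [/\ 0 < s, A s & forall r, 0 < r -> A r -> s <= r] & s <= t.
  elim/ltn_ind: t => t IH t0 At.
  case: (classic (exists r, [/\ 0 < r, A r & r < t])) => [[r [r0 Ar rt]]|no].
    by have [s sP sr] := IH r rt r0 Ar; exists s; rewrite // (leq_trans sr) // ltnW.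
  exists t => //; split=> // r r0 Ar; rewrite leqNgt; apply/negP => rt.
  by apply: no; exists r.
apply: least; first by rewrite addn1.
apply: arrows_of_large => //.
(* The summand 1 makes 2n < j(floor(2n/j) + 1) strict. *)
by rewrite [j * _]mulnC addn1 ltn_ceil // (leq_trans _ hj).
Qed.
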